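(* A matrix $M\in\mathrm{GL}(2,\mathbb Z)$ lies in the image of $\phi:\Pi A_2\to \mathrm{GL}(2,\mathbb Z)$ if and only if it has one of the following eight forms $$\pm\begin{pmatrix}1+4a_{11}&2a_{12}\\2a_{21}&1+4a_{22}\end{pmatrix},\quad \pm\begin{pmatrix}1+4a_{11}&-2a_{12}\\2a_{21}&-1-4a_{22}\end{pmatrix},$$ $$\pm\begin{pmatrix}2a_{12}&-1-4a_{11}\\1+4a_{22}&-2a_{21}\end{pmatrix},\quad \pm\begin{pmatrix}2a_{12}&1+4a_{11}\\1+4a_{22}&2a_{21}\end{pmatrix},$$ for some integers $a_{11},a_{12},a_{21},a_{22}$ satisfying $a_{11}+a_{22}-a_{12}a_{21}+4a_{11}a_{22}=0$.
   Context: $F_2=\langle x,y\rangle$ is the free group of rank 2. A palindrome is a reduced word in $x^{\pm1},y^{\pm1}$ that equals its reverse word. $\Pi A_2\le\mathrm{Aut}(F_2)$ is the group of all automorphisms mapping each of $x,y$ to a palindrome. Automorphisms act on the right, so products are composed from left to right. The group $\Pi A_2$ is generated by $\mu_{12}: x\mapsto yxy,\ y\mapsto y$; $\mu_{21}: x\mapsto x,\ y\mapsto xyx$; $\sigma: x\mapsto x^{-1},\ y\mapsto y$; $\delta: x\mapsto x,\ y\mapsto y^{-1}$; $\rho: x\mapsto y,\ y\mapsto x$. The representation $\phi:\Pi A_2\to\mathrm{GL}(2,\mathbb Z)$ is the homomorphism with $\phi(\mu_{12})=\begin{pmatrix}1&2\\0&1\end{pmatrix}$, $\phi(\mu_{21})=\begin{pmatrix}1&0\\2&1\end{pmatrix}$,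 $\phi(\sigma)=\begin{pmatrix}-1&0\\0&1\end{pmatrix}$, $\phi(\delta)=\begin{pmatrix}1&0\\0&-1\end{pmatrix}$, $\phi(\rho)=\begin{pmatrix}0&1\\1&0\end{pmatrix}$; it is the restriction to $\Pi A_2$ of the natural homomorphism $\mathrm{Aut}(F_2)\to \mathrm{GL}(2,\mathbb Z)$ given by the action on the abelianization (rows record exponent sums of the images of $x$ and $y$). *)

(* Defs.v *)
From HB Require Import structures.
From mathcomp Require Import all_boot all_order all_algebra.

Set Implicit Arguments.
Unset Strict Implicit.
Unset Printing Implicit Defensive.

Import GRing.Theory.

(* The letter (i, b) is the i-th generator (x for i = 0, y for i = 1), inverted *)
(* when b = true.                                                               *)
Notation letter := ('I_2 * bool)%type.

Definition inv_letter (a : letter) : letter := (a.1, ~~ a.2).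

Definition reduced (w : seq letter) : bool :=
  sorted (fun a b => b != inv_letter a) w.

(* Left multiplication of a reduced word by a letter, with cancellation. *)
Definition cons_letter (a : letter) (w : seq letter) : seq letter :=
  if w is b :: w' then if b == inv_letter a then w' else a :: w else [:: a].

Definition mul_word (u v : seq letter) : seq letter := foldr cons_letter v u.

Definition inv_word (u : seq letter) : seq letter := rev (map inv_letter u).

Lemma inv_letterK : involutive inv_letter.
Proof. by case=> i b; rewrite /inv_letter /= negbK. Qed.

Lemma cons_letter_reduced a w : reduced w -> reduced (cons_letter a w).
Proof.
case: w => [|b w] //= bw; case: eqP => [_|/eqP nab] /=; last by rewrite nab.
exact: path_sorted bw.
Qed.

Lemma mul_word_reduced u v : reduced v -> reduced (mul_word u v).
Proof. by move=> rv; elim: u => //= a u; apply: cons_letter_reduced. Qed.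

Lemma cons_letterK a w :
  reduced w -> cons_letter a (cons_letter (inv_letter a) w) = w.
Proof.
case: w => [|b w] /=; first by rewrite eqxx.
rewrite inv_letterK; case: (b =P a) => [->|_] rw /=; last by rewrite eqxx.
by case: w rw => //= c w /andP[/negbTE ->].
Qed.

Lemma mul_word_cons a u w :
  reduced w -> mul_word (cons_letter a u) w = cons_letter a (mul_word u w).
Proof.
move=> rw; case: u => //= b u; case: eqP => //= ->.
by rewrite cons_letterK // mul_word_reduced.
Qed.

Lemma mul_wordA u v w :
  reduced w -> mul_word u (mul_word v w) = mul_word (mul_word u v) w.
Proof. by move=> rw; elim: u => //= a u ->; rewrite mul_word_cons. Qed.

Lemma mul_word0 u : reduced u -> mul_word u [::] = u.
Proof.
elim: u => //= a u IHu rau; rewrite IHu; last exact: path_sorted rau.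
by case: u rau {IHu} => //= b u /andP[/negbTE ->].
Qed.

Lemma mul_inv_word u v : reduced v -> mul_word (inv_word u) (mul_word u v) = v.
Proof.
move=> rv; elim: u => //= a u IHu.
rewrite /inv_word /= rev_cons /mul_word foldr_rcons -/(mul_word u v).
by rewrite -{2}[a]inv_letterK cons_letterK ?mul_word_reduced.
Qed.

Lemma inv_wordK : involutive inv_word.
Proof.
by move=> u; rewrite /inv_word map_rev revK -map_comp map_id_in // => a _ /=;
  rewrite inv_letterK.
Qed.

Lemma inv_word_reduced u : reduced u -> reduced (inv_word u).
Proof.
rewrite /reduced /inv_word rev_sorted sorted_map; apply: sub_sorted => a b /=.
by apply: contra => /eqP ->; rewrite !inv_letterK.
Qed.

Definition F2 : Type := {w : seq letter | reduced w}.
HB.instance Definition _ := SubChoice.on F2.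

Definition F2_one : F2 := exist _ [::] isT.
Definition F2_mul (u v : F2) : F2 :=
  exist _ (mul_word (val u) (val v)) (mul_word_reduced (val u) (valP v)).
Definition F2_inv (u : F2) : F2 :=
  exist _ (inv_word (val u)) (inv_word_reduced (valP u)).

Lemma F2_mulA : associative F2_mul.
Proof. by move=> u v w; apply: val_inj; rewrite /= mul_wordA ?(valP w). Qed.

Lemma F2_mul1 : left_id F2_one F2_mul.
Proof. by move=> u; apply: val_inj. Qed.

Lemma F2_mulr1 : right_id F2_one F2_mul.
Proof. by move=> u; apply: val_inj; rewrite /= mul_word0 ?(valP u). Qed.

Lemma F2_mulV : left_inverse F2_one F2_inv F2_mul.
Proof.
move=> u; apply: val_inj => /=.
by rewrite -[X in mul_word _ X]mul_word0 ?(valP u) // mul_inv_word.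
Qed.

Lemma F2_mulrV : right_inverse F2_one F2_inv F2_mul.
Proof.
move=> u; have := F2_mulV (F2_inv u); congr (F2_mul _ _ = _).
by apply: val_inj; rewrite /= inv_wordK.
Qed.

HB.instance Definition _ :=
  isGroup.Build F2 F2_mulA F2_mul1 F2_mulr1 F2_mulV F2_mulrV.

Definition gen (i : 'I_2) : F2 := exist _ [:: (i, false)] isT.

Definition palindrome (w : F2) : bool := rev (val w) == val w.

(* Membership in PiA_2, seen inside the endomorphisms of F2. *)
Definition palindromic_aut (alpha : {multiplicative F2 -> F2}) : Prop :=
  bijective alpha /\ forall i : 'I_2, palindrome (alpha (gen i)).

Local Open Scope ring_scope.

Definition expsum (j : 'I_2) (w : F2) : int :=
  \sum_(a <- val w | a.1 == j) (-1) ^+ a.2.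

Definition phi (alpha : {multiplicative F2 -> F2}) : 'M[int]_2 :=
  \matrix_(i, j) expsum j (alpha (gen i)).

Definition mx22 (a b c d : int) : 'M[int]_2 :=
  \matrix_(i, j) if i == 0 then (if j == 0 then a else b)
                 else (if j == 0 then c else d).

Lemma expsumM j (u v : F2) : expsum j (u * v)%g = expsum j u + expsum j v.
Proof.
case: u v => [u ru] [v rv]; rewrite /expsum /= {ru rv}.
elim: u => [|a u IHu] /=; first by rewrite big_nil add0r.
rewrite big_cons; transitivity ((if a.1 == j then (-1) ^+ a.2 else 0) +
    \sum_(b <- mul_word u v | b.1 == j) (-1) ^+ b.2 : int); last first.
  by rewrite IHu; case: ifP => _; rewrite ?add0r ?addrA.
case: (mul_word u v) => [|b w] /=.
  by rewrite big_cons big_nil; case: ifP; rewrite ?addr0.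
case: eqP => [->|_]; rewrite !big_cons; last by case: ifP; rewrite ?add0r.
case: a {IHu} => i [] /=; case: ifP => _; rewrite ?add0r //.
  by rewrite expr1 expr0 addKr.
by rewrite expr1 expr0 addrA subrr add0r.
Qed.

Lemma expsum1 j : expsum j 1%g = 0.
Proof. by rewrite /expsum big_nil. Qed.

Lemma expsumV j (u : F2) : expsum j u^-1%g = - expsum j u.
Proof. by apply: (addrI (expsum j u)); rewrite -expsumM mulgV expsum1 subrr. Qed.

Lemma expsum_gen i j : expsum j (gen i) = (i == j)%:R.
Proof. by rewrite /expsum big_cons big_nil /=; case: eqP; rewrite ?addr0. Qed.

Lemma expsum_morph j (alpha : {multiplicative F2 -> F2}) (w : F2) :
  expsum j (alpha w) = \sum_i expsum i w * phi alpha i j.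
Proof.
have a1 : alpha 1%g = 1%g :> F2.
  by apply: (mulgI (alpha 1%g)); rewrite -gmulfM !mulg1.
have aV u : alpha u^-1%g = (alpha u)^-1%g.
  by apply: (mulgI (alpha u)); rewrite -gmulfM !mulgV.
case: w => w; elim: w => [|[i b] w IHw] rw.
  have -> : exist _ [::] rw = 1%g :> F2 by apply: val_inj.
  by rewrite a1 expsum1 big1 // => i _; rewrite expsum1 mul0r.
have rw' : reduced w by apply: path_sorted rw.
have -> : exist _ ((i, b) :: w) rw =
    ((if b then (gen i)^-1 else gen i) * exist _ w rw' : F2)%g.
  apply: val_inj; rewrite /= [LHS](_ : _ = cons_letter (i, b) w).
    by case: b {rw}.
  by case: w rw {IHw rw'} => //= c w /andP[/negbTE ->].
rewrite gmulfM expsumM IHw.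
under [RHS]eq_bigr => k _ do rewrite expsumM mulrDl.
rewrite big_split /=; congr (_ + _).
rewrite (bigD1 i) //= big1 ?addr0 => [|k /negbTE nki].
  by case: b {rw}; rewrite ?aV ?expsumV expsum_gen eqxx ?mulN1r ?mul1r mxE.
by case: b {rw}; rewrite ?expsumV expsum_gen eq_sym nki ?oppr0 mul0r.
Qed.

(* Automorphisms act on the right: the product "alpha, then beta" is the *)
(* function beta \o alpha.                                               *)
Lemma phi_comp (alpha beta : {multiplicative F2 -> F2}) :
  phi (beta \o alpha) = phi alpha *m phi beta.
Proof.
apply/matrixP => i j; rewrite [LHS]mxE /= expsum_morph [RHS]mxE.
by apply: eq_bigr => k _; rewrite [phi alpha i k]mxE.
Qed.

Section PhiGenerators.
Variable alpha : {multiplicative F2 -> F2}.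
Let x : F2 := gen 0.
Let y : F2 := gen 1.

Let phiE u v : alpha x = u -> alpha y = v ->
  phi alpha = mx22 (expsum 0 u) (expsum 1 u) (expsum 0 v) (expsum 1 v).
Proof.
move=> <- <-; have I2 (i : 'I_2) : i = 0 \/ i = 1.
  by case: i => [[|[|//]] ?]; [left | right]; apply: val_inj.
by apply/matrixP => i j; rewrite !mxE; case: (I2 i) (I2 j) => -> [] ->.
Qed.

Let simp := (expsumM, expsumV, expsum_gen).

Lemma phi_mu12 : alpha x = (y * x * y)%g -> alpha y = y ->
  phi alpha = mx22 1 2 0 1.
Proof. by move=> ax ay; rewrite (phiE ax ay) /x /y !simp; congr mx22. Qed.

Lemma phi_mu21 : alpha x = x -> alpha y = (x * y * x)%g ->
  phi alpha = mx22 1 0 2 1.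
Proof. by move=> ax ay; rewrite (phiE ax ay) /x /y !simp; congr mx22. Qed.

Lemma phi_sigma : alpha x = x^-1%g -> alpha y = y ->
  phi alpha = mx22 (-1) 0 0 1.
Proof. by move=> ax ay; rewrite (phiE ax ay) /x /y !simp; congr mx22. Qed.

Lemma phi_delta : alpha x = x -> alpha y = y^-1%g ->
  phi alpha = mx22 1 0 0 (-1).
Proof. by move=> ax ay; rewrite (phiE ax ay) /x /y !simp; congr mx22. Qed.

Lemma phi_rho : alpha x = y -> alpha y = x -> phi alpha = mx22 0 1 1 0.
Proof. by move=> ax ay; rewrite (phiE ax ay) /x /y !simp; congr mx22. Qed.
End PhiGenerators.

(* Main.v *)
Require Import Defs.
From mathcomp Require Import all_boot all_order all_algebra.
From HB Require Import structures.
From mathcomp Require Import zify ring.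

(** In a palindrome of even length both generators occur an even number of
times; in one of odd length exactly one of them, that of the middle letter,
occurs an odd number of times.  A palindrome therefore has an even exponent sum
([palindrome_expsum_even]), so each row of [phi alpha] has an even entry when
[alpha] is palindromic.  If moreover the determinant is 1 or -1, these two
entries lie in different columns and the other two are odd: modulo 2 the matrix
is a permutation matrix ([realizable_perm_mod2]).

Conversely every integer matrix of determinant 1 or -1 with such a reduction
modulo 2 is realized ([perm_mod2_realizable]).  Palindromic automorphisms are
closed under composition, because they map palindromes to palindromes
([palindrome_morph]); so it is enough to factor the matrix into values of [phi]
at rho, sigma and mu_12.  After multiplication by [phi rho] if necessary, the
matrix is the identity modulo 2.  Its first row (a, b) then has a odd and b
even, so that |a| and |b| differ; as long as b is nonzero, changing the entry
of larger absolute value by twice the other one shortens the row, and this is a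
multiplication by a conjugate of the value at mu_12 ([realizable_id_mod2]).

The matrices so described are exactly those of the eight forms: the product of
the two even entries is a multiple of 4, so the product of the two odd entries
is congruent to the determinant modulo 4, up to the sign of the permutation.
The four choices of signs bringing the odd entries to 1 modulo 4, for each of
the two permutations, give the eight forms, and the determinant equation
becomes the relation between the a_ij ([odd_even_det], [parity_eight_forms]). *)

Local Open Scope ring_scope.
Import Order.TTheory GRing.Theory.

(** * Homomorphisms out of the free group *)

Lemma ord2P (P : 'I_2 -> Prop) : P 0 -> P 1 -> forall i, P i.
Proof.
move=> P0 P1 i; have [->|->] // : i = 0 \/ i = 1.
by case: i => [[|[|//]] lti]; [left | right]; apply: val_inj.
Qed.

Definition letter_val (f : 'I_2 -> F2) (a : letter) : F2 :=
  if a.2 then (f a.1)^-1%g else f a.1.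

Definition F2_lift (f : 'I_2 -> F2) (w : F2) : F2 :=
  foldr (fun a u => letter_val f a * u)%g 1%g (val w).

Lemma F2_lift_is_multiplicative f : {morph F2_lift f : u v / (u * v)%g}.
Proof.
pose F := foldr (fun a u => letter_val f a * u)%g (1%g : F2).
have Fcons a w : F (cons_letter a w) = (letter_val f a * F w)%g.
  case: w => [|b w] //=; case: eqP => //= ->.
  by case: a => i [] /=; rewrite /letter_val /= ?mulKg ?mulVKg.
move=> [u ru] [v rv]; rewrite /F2_lift /= -/(F _) -/(F _) -/(F _).
by elim: u {ru} => [|a u IHu] /=; rewrite ?mul1g // Fcons IHu mulgA.
Qed.

HB.instance Definition _ f :=
  isMultiplicative.Build F2 F2 (F2_lift f) (F2_lift_is_multiplicative f).

Lemma F2_lift_gen f i : F2_lift f (gen i) = f i.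
Proof. by rewrite /F2_lift /= mulg1. Qed.

Lemma F2_consE (a : letter) w (raw : reduced (a :: w)) (rw : reduced w) :
  exist _ (a :: w) raw = (letter_val gen a * exist _ w rw)%g :> F2.
Proof.
apply: val_inj => /=; rewrite [RHS](_ : _ = cons_letter a w).
  by case: w raw {rw} => //= b w /andP[/negbTE ->].
by case: a {raw} => i [].
Qed.

Lemma morph1g (G H : groupType) (f : {multiplicative G -> H}) : f 1%g = 1%g.
Proof. by apply: (mulgI (f 1%g)); rewrite -gmulfM !mulg1. Qed.

Lemma morphVg (G H : groupType) (f : {multiplicative G -> H}) u :
  f u^-1%g = (f u)^-1%g.
Proof. by apply: (mulgI (f u)); rewrite -gmulfM !mulgV morph1g. Qed.

Lemma F2_morph_ext (f g : {multiplicative F2 -> F2}) :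
  (forall i, f (gen i) = g (gen i)) -> f =1 g.
Proof.
move=> fg [w]; elim: w => [|a w IHw] raw.
  have -> : exist _ [::] raw = 1%g :> F2 by apply: val_inj.
  by rewrite !morph1g.
have rw : reduced w by apply: path_sorted raw.
rewrite (F2_consE _ _ _ rw) !gmulfM IHw; congr (_ * _)%g.
by case: a {raw} => i [] /=; rewrite /letter_val /= ?morphVg fg.
Qed.

(** * Palindromes *)

(** The automorphism inverting both generators turns the reversal of words,
an anti-automorphism, into group inversion; palindromes thereby become the
solutions of an equation between group elements, which homomorphisms can be
applied to. *)
Definition inv_gens : F2 -> F2 := F2_lift (fun i => (gen i)^-1%g).

Lemma val_inv_gens w : val (inv_gens w) = map inv_letter (val w).
Proof.
case: w; elim=> [|a w IHw] raw //.
have rw : reduced w by apply: path_sorted raw.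
have := IHw rw; rewrite /inv_gens /F2_lift /= => IH.
rewrite [LHS](_ : _ = cons_letter (inv_letter a) (map inv_letter w)).
  case: w raw {IHw rw IH} => //= b w /andP[/negbTE nba _].
  by rewrite (inj_eq (inv_inj inv_letterK)) nba.
by rewrite -IH; case: a {raw} => i [].
Qed.

Lemma palindromeE w : palindrome w = (inv_gens w == w^-1%g).
Proof.
rewrite -val_eqE val_inv_gens /= /inv_word -map_rev eq_sym.
by rewrite (inj_eq (inj_map (inv_inj inv_letterK))).
Qed.

(** On generators, whose images are palindromes, [alpha] commutes with
[inv_gens]; hence it does everywhere. *)
Lemma palindrome_morph (alpha : {multiplicative F2 -> F2}) w :
  (forall i, palindrome (alpha (gen i))) ->
  palindrome w -> palindrome (alpha w).
Proof.
move=> pal_alpha; rewrite !palindromeE => /eqP pal_w.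
have comm : F2_lift (fun i => (gen i)^-1%g) \o alpha =1
            alpha \o F2_lift (fun i => (gen i)^-1%g).
  apply: F2_morph_ext => i /=.
  by have := pal_alpha i; rewrite palindromeE F2_lift_gen morphVg => /eqP.
by rewrite [inv_gens _]comm /= -/inv_gens pal_w morphVg.
Qed.

Lemma palindrome_expsum_even w :
  palindrome w -> exists j k, expsum j w = 2 * k.
Proof.
case: w => w rw; rewrite /palindrome /expsum /= {rw} => /eqP.
(* The outer two letters of a palindrome coincide, so removing both changes
   each exponent sum by an even number. *)
have [n] := ubnP (size w); elim: n w => // n IHn [|a w].
  by move=> _ _; exists 0, 0; rewrite big_nil.
case/lastP: w => [|w b] /=; rewrite ltnS => szw.
  (* A single letter has exponent sum 0 at the other generator. *)
  move=> _; case: a => i s; exists (1 - i), 0; rewrite big_cons big_nil /=.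
  by move: i; apply: ord2P.
rewrite rev_cons rev_rcons rcons_cons => -[-> /rcons_inj[pal_w]].
have [|j [k Ek]] := IHn w _ pal_w; first by rewrite size_rcons in szw; lia.
exists j; rewrite big_cons -cats1 big_cat big_cons big_nil /= Ek.
case: (a.1 == j); last by exists k; rewrite addr0.
by exists ((-1) ^+ a.2 + k); move: (_ ^+ _) => e; ring.
Qed.

(** * The matrices realized by palindromic automorphisms *)

Definition realizable (M : 'M[int]_2) : Prop :=
  exists alpha : {multiplicative F2 -> F2}, palindromic_aut alpha /\ phi alpha = M.

Lemma realizable_mul A B : realizable A -> realizable B -> realizable (A *m B).
Proof.
move=> [alpha [[bij_a pal_a] <-]] [beta [[bij_b pal_b] <-]].
exists (beta \o alpha : {multiplicative F2 -> F2}); rewrite phi_comp; split=> //.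
split; first exact: bij_comp.
by move=> i /=; apply: palindrome_morph.
Qed.

(* The scope is explicit because 1%g is the zero of 'I_2. *)
Local Notation gx := (gen 0%R).
Local Notation gy := (gen 1%R).

Definition pair_fun (u v : F2) (i : 'I_2) : F2 := if i == 0 then u else v.

Definition endo (u v : F2) : {multiplicative F2 -> F2} := F2_lift (pair_fun u v).

Lemma endo0 u v : endo u v gx = u. Proof. exact: F2_lift_gen. Qed.
Lemma endo1 u v : endo u v gy = v. Proof. exact: F2_lift_gen. Qed.

(** Mutual inverseness of two endomorphisms need only be checked on the
generators. *)
Lemma palindromic_aut_endo u v u' v' :
  endo u' v' u = gx -> endo u' v' v = gy ->
  endo u v u' = gx -> endo u v v' = gy ->
  palindrome u -> palindrome v -> palindromic_aut (endo u v).
Proof.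
move=> Eu Ev Eu' Ev' pal_u pal_v; split; last first.
  by apply: ord2P; rewrite (endo0, endo1).
have inv (f g : {multiplicative F2 -> F2}) :
    g (f gx) = gx -> g (f gy) = gy -> cancel f g.
  move=> E0 E1; apply: (F2_morph_ext (g \o f) idfun).
  by apply: ord2P.
by exists (endo u' v'); apply: inv; rewrite (endo0, endo1).
Qed.

Lemma realizable_rho : realizable (mx22 0 1 1 0).
Proof.
exists (endo gy gx); split; last by apply: phi_rho; rewrite (endo0, endo1).
by apply: (@palindromic_aut_endo _ _ gy gx); rewrite ?(endo0, endo1).
Qed.

Lemma realizable_sigma : realizable (mx22 (-1) 0 0 1).
Proof.
exists (endo gx^-1%g gy); split.
  by apply: (@palindromic_aut_endo _ _ gx^-1%g gy);
    rewrite ?morphVg ?(endo0, endo1) ?invgK.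
by apply: phi_sigma; rewrite (endo0, endo1).
Qed.

Lemma realizable_mu12 : realizable (mx22 1 2 0 1).
Proof.
exists (endo (gy * gx * gy)%g gy); split.
  apply: (@palindromic_aut_endo _ _ (gy^-1 * gx * gy^-1)%g gy).
  - by rewrite !gmulfM !(endo0, endo1) !mulgA mulgV mul1g mulgVK.
  - by rewrite endo1.
  - by rewrite !gmulfM !morphVg !(endo0, endo1) !mulgA mulVg mul1g mulgK.
  - by rewrite endo1.
  - by [].
  - by [].
by apply: phi_mu12; rewrite (endo0, endo1).
Qed.

(** * Two by two integer matrices *)

Lemma mx22_eta (M : 'M[int]_2) : M = mx22 (M 0 0) (M 0 1) (M 1 0) (M 1 1).
Proof. by apply/matrixP; apply: ord2P; apply: ord2P; rewrite mxE. Qed.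

Lemma mul_mx22 a b c d a' b' c' d' :
  mx22 a b c d *m mx22 a' b' c' d' =
  mx22 (a * a' + b * c') (a * b' + b * d') (c * a' + d * c') (c * b' + d * d').
Proof.
apply/matrixP => i j; rewrite !mxE !big_ord_recl big_ord0 addr0 !mxE /=.
by move: i j; apply: ord2P; apply: ord2P.
Qed.

Lemma opp_mx22 a b c d : - mx22 a b c d = mx22 (- a) (- b) (- c) (- d).
Proof. by apply/matrixP; apply: ord2P; apply: ord2P; rewrite !mxE. Qed.

Lemma unit_mx22 (a b c d : int) :
  mx22 a b c d \in unitmx -> a * d - b * c = 1 \/ a * d - b * c = -1.
Proof.
rewrite unitmxE (expand_det_row _ 0) !big_ord_recl big_ord0 /cofactor !det_mx11.
rewrite !mxE /= addr0 expr0 expr1 mul1r mulN1r mulrN.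
by case/orP=> /eqP; [left | right].
Qed.

Lemma int_mul_sign (p q : int) : p * q = 1 \/ p * q = -1 ->
  (p = 1 \/ p = -1) /\ (q = 1 \/ q = -1).
Proof.
move=> pq1; have /eqP : absz (p * q) = 1%N by lia.
by rewrite abszM muln_eq1 => /andP[/eqP p1 /eqP q1]; lia.
Qed.

(** * Row reduction within the realizable matrices *)

Lemma realizable_mu12V : realizable (mx22 1 (-2) 0 1).
Proof.
have -> : mx22 1 (-2) 0 1 =
    mx22 (-1) 0 0 1 *m mx22 1 2 0 1 *m mx22 (-1) 0 0 1.
  by rewrite !mul_mx22.
have [Rs Rm] := (realizable_sigma, realizable_mu12).
by do 2![apply: realizable_mul => //].
Qed.

(** Conjugation by rho, which exchanges the two generators. *)
Lemma realizable_swap (a b c d : int) :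
  realizable (mx22 a b c d) -> realizable (mx22 d c b a).
Proof.
move=> R; have -> : mx22 d c b a =
    mx22 0 1 1 0 *m mx22 a b c d *m mx22 0 1 1 0.
  by rewrite !mul_mx22; congr mx22; ring.
have Rr := realizable_rho.
by do 2![apply: realizable_mul => //].
Qed.

Lemma realizable_one : realizable (mx22 1 0 0 1).
Proof.
have -> : mx22 1 0 0 1 = mx22 0 1 1 0 *m mx22 0 1 1 0 by rewrite mul_mx22.
exact: realizable_mul realizable_rho realizable_rho.
Qed.

Lemma realizable_sign (a b c d : int) :
  realizable (mx22 a b c d) -> realizable (mx22 (- a) (- b) c d).
Proof.
move=> R; have -> : mx22 (- a) (- b) c d = mx22 (-1) 0 0 1 *m mx22 a b c d.
  by rewrite mul_mx22; congr mx22; ring.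
exact: realizable_mul realizable_sigma R.
Qed.

Lemma realizable_lower k : realizable (mx22 1 0 (2 * k) 1).
Proof.
have Rnat (n : nat) : realizable (mx22 1 0 (2 * n%:Z) 1).
  elim: n => [|n IHn]; first exact: realizable_one.
  have -> : mx22 1 0 (2 * n.+1%:Z) 1 = mx22 1 0 (2 * n%:Z) 1 *m mx22 1 0 2 1.
    by rewrite mul_mx22; congr mx22; lia.
  exact: realizable_mul IHn (realizable_swap _ _ _ _ realizable_mu12).
case: (intP k) => [|n|n]; try exact: Rnat.
have -> : mx22 1 0 (2 * - n.+1%:Z) 1 =
    mx22 (-1) 0 0 1 *m mx22 1 0 (2 * n.+1%:Z) 1 *m mx22 (-1) 0 0 1.
  by rewrite !mul_mx22; congr mx22; lia.
have Rs := realizable_sigma.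
by do 2![apply: realizable_mul => //].
Qed.

Lemma realizable_diag a d : a = 1 \/ a = -1 -> d = 1 \/ d = -1 ->
  realizable (mx22 a 0 0 d).
Proof.
have Rd e : e = 1 \/ e = -1 -> realizable (mx22 1 0 0 e).
  case=> ->; first exact: realizable_one.
  exact: realizable_swap realizable_sigma.
by case=> -> /Rd // /realizable_sign; rewrite oppr0.
Qed.

(** Induction on |2a + 1| + |2b|: the Euclidean algorithm with quotients 2 and
-2 on the first row, carried out by right multiplication.  It ends with b = 0,
where the matrix is triangular with diagonal entries 1 or -1. *)
Lemma realizable_id_mod2 (a b c d : int) :
  mx22 (2 * a + 1) (2 * b) (2 * c) (2 * d + 1) \in unitmx ->
  realizable (mx22 (2 * a + 1) (2 * b) (2 * c) (2 * d + 1)).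
Proof.
move=> /unit_mx22 det1; have {det1} : (2 * a + 1) * (2 * d + 1) - 4 * b * c = 1
  \/ (2 * a + 1) * (2 * d + 1) - 4 * b * c = -1.
  by case: det1 => det1; [left | right]; rewrite -[RHS]det1; ring.
have Rmu12 := realizable_mu12; have Rmu12V := realizable_mu12V.
have Rmu21 := realizable_swap _ _ _ _ Rmu12.
have Rmu21V := realizable_swap _ _ _ _ Rmu12V.
have [n] := ubnP (absz (2 * a + 1)%R + absz (2 * b)%R)%N.
elim: n a b c d => // n IHn a b c d lt_n det1.
have [b0|b_neq0] := eqVneq b 0.
  subst b.
  have [a1 d1] : (2 * a + 1 = 1 \/ 2 * a + 1 = -1) /\
                 (2 * d + 1 = 1 \/ 2 * d + 1 = -1).
    by apply: int_mul_sign; move: det1; rewrite mulr0 mul0r subr0.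
  (* The last factor is correct because (2 * d + 1) ^+ 2 = 1. *)
  have -> : mx22 (2 * a + 1) (2 * 0) (2 * c) (2 * d + 1) =
      mx22 (2 * a + 1) 0 0 (2 * d + 1) *m
      mx22 1 0 (2 * ((2 * d + 1) * c)) 1.
    by rewrite mul_mx22; case: d1 => ->; congr mx22; ring.
  by apply: realizable_mul (realizable_diag _ _ a1 d1) (realizable_lower _).
(* The entry of larger absolute value moves towards zero by twice the other;
   which multiple of 2 is added depends on whether the signs agree. *)
have [lt_ab|le_ba] := ltP `|2 * a + 1| `|2 * b|.
- have [same|opposite] := boolP ((0 <= a) == (0 <= b)).
  + have -> : mx22 (2 * a + 1) (2 * b) (2 * c) (2 * d + 1) =
        mx22 (2 * a + 1) (2 * (b - (2 * a + 1)))
             (2 * c) (2 * (d - 2 * c) + 1) *m mx22 1 2 0 1.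
      by rewrite mul_mx22; congr mx22; ring.
    by apply: realizable_mul Rmu12; apply: IHn; lia.
  + have -> : mx22 (2 * a + 1) (2 * b) (2 * c) (2 * d + 1) =
        mx22 (2 * a + 1) (2 * (b + (2 * a + 1)))
             (2 * c) (2 * (d + 2 * c) + 1) *m mx22 1 (-2) 0 1.
      by rewrite mul_mx22; congr mx22; ring.
    by apply: realizable_mul Rmu12V; apply: IHn; lia.
- have [same|opposite] := boolP ((0 <= a) == (0 <= b)).
  + have -> : mx22 (2 * a + 1) (2 * b) (2 * c) (2 * d + 1) =
        mx22 (2 * (a - 2 * b) + 1) (2 * b)
             (2 * (c - (2 * d + 1))) (2 * d + 1) *m mx22 1 0 2 1.
      by rewrite mul_mx22; congr mx22; ring.
    by apply: realizable_mul Rmu21; apply: IHn; lia.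
  + have -> : mx22 (2 * a + 1) (2 * b) (2 * c) (2 * d + 1) =
        mx22 (2 * (a + 2 * b) + 1) (2 * b)
             (2 * (c + (2 * d + 1))) (2 * d + 1) *m mx22 1 0 (-2) 1.
      by rewrite mul_mx22; congr mx22; ring.
    by apply: realizable_mul Rmu21V; apply: IHn; lia.
Qed.

(** * The image of the representation *)

(** The reduction of [M] modulo 2 is a permutation matrix. *)
Definition perm_mod2 (M : 'M[int]_2) : Prop :=
  exists a b c d : int,
    M = mx22 (2 * a + 1) (2 * b) (2 * c) (2 * d + 1) \/
    M = mx22 (2 * b) (2 * a + 1) (2 * d + 1) (2 * c).

Lemma perm_mod2_realizable M : M \in unitmx -> perm_mod2 M -> realizable M.
Proof.
move=> uM [a [b [c [d [EM|EM]]]]].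
  by rewrite EM; apply: realizable_id_mod2; rewrite -EM.
have ER : M = mx22 (2 * a + 1) (2 * b) (2 * c) (2 * d + 1) *m mx22 0 1 1 0.
  by rewrite EM mul_mx22; congr mx22; ring.
rewrite ER; apply: realizable_mul realizable_rho; apply: realizable_id_mod2.
by move: uM; rewrite ER unitmx_mul => /andP[].
Qed.

Lemma realizable_perm_mod2 M : M \in unitmx -> realizable M -> perm_mod2 M.
Proof.
move=> uM [alpha [[_ pal] EM]].
have even_row i : exists k, M i 0 = 2 * k \/ M i 1 = 2 * k.
  have [j [k Ek]] := palindrome_expsum_even _ (pal i).
  exists k; rewrite -EM !mxE -Ek.
  by move: j {Ek}; apply: ord2P; [left | right].
move: uM (even_row 0) (even_row 1); rewrite {}/perm_mod2 (mx22_eta M) {even_row EM}.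
move: (M 0 0) (M 0 1) (M 1 0) (M 1 1) => p q r s /unit_mx22 det1.
rewrite !mxE /= => -[k Ek] [l El].
(* Even entries of both rows in the same column would make the determinant
   even. *)
case: Ek det1 => ->; case: El => -> det1; first [exfalso; lia | idtac].
  have [Eq Er] : (q %% 2 = 1)%Z /\ (r %% 2 = 1)%Z by nia.
  by exists (q %/ 2)%Z, k, l, (r %/ 2)%Z; right; congr mx22; lia.
have [Eq Er] : (p %% 2 = 1)%Z /\ (s %% 2 = 1)%Z by nia.
by exists (p %/ 2)%Z, k, l, (s %/ 2)%Z; left; congr mx22; lia.
Qed.

(** The signs s and t bring the odd entries to 1 modulo 4.  As [det] is
congruent to their product s t modulo 4, it equals s t, and dividing
[det = s * t] by 4 gives the last equation. *)
Lemma odd_even_det (a b c d : int) :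
  let det := (2 * a + 1) * (2 * d + 1) - 2 * b * (2 * c) in
  det = 1 \/ det = -1 ->
  exists s t a' d' : int,
    [/\ s = 1 \/ s = -1, t = 1 \/ t = -1,
        2 * a + 1 = s * (1 + 4 * a'), 2 * d + 1 = t * (1 + 4 * d')
      & a' + d' - s * t * (b * c) + 4 * a' * d' = 0].
Proof.
have odd_sign (m : int) : exists s m' : int,
    (s = 1 \/ s = -1) /\ 2 * m + 1 = s * (1 + 4 * m').
  have [e|e] : (m %% 2 = 0)%Z \/ (m %% 2 = 1)%Z by lia.
    by exists 1, (m %/ 2)%Z; split; [left | lia].
  by exists (-1), (- (m %/ 2)%Z - 1); split; [right | lia].
have [s [a' [s1 Ea]]] := odd_sign a; have [t [d' [t1 Ed]]] := odd_sign d.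
move=> det /= det1; exists s, t, a', d'; split=> //; move: det1.
by rewrite /det Ea Ed; case: s1 => ->; case: t1 => ->; lia.
Qed.

Lemma parity_eight_forms (M : 'M[int]_2) : M \in unitmx ->
  (perm_mod2 M <->
   exists a11 a12 a21 a22 : int,
     a11 + a22 - a12 * a21 + 4 * a11 * a22 = 0 /\
     (M =   mx22 (1 + 4 * a11) (2 * a12) (2 * a21) (1 + 4 * a22) \/
      M = - mx22 (1 + 4 * a11) (2 * a12) (2 * a21) (1 + 4 * a22) \/
      M =   mx22 (1 + 4 * a11) (- 2 * a12) (2 * a21) (- 1 - 4 * a22) \/
      M = - mx22 (1 + 4 * a11) (- 2 * a12) (2 * a21) (- 1 - 4 * a22) \/
      M =   mx22 (2 * a12) (- 1 - 4 * a11) (1 + 4 * a22) (- 2 * a21) \/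
      M = - mx22 (2 * a12) (- 1 - 4 * a11) (1 + 4 * a22) (- 2 * a21) \/
      M =   mx22 (2 * a12) (1 + 4 * a11) (1 + 4 * a22) (2 * a21) \/
      M = - mx22 (2 * a12) (1 + 4 * a11) (1 + 4 * a22) (2 * a21))).
Proof.
move=> uM; split; last first.
  move=> [a [b [c [d [_ EM]]]]]; rewrite /perm_mod2.
  (* The witness - 2 * a - 1 comes from
     - (1 + 4 * a) = 2 * (- 2 * a - 1) + 1. *)
  case: EM => [->|[->|[->|[->|[->|[->|[->|->]]]]]]]; rewrite ?opp_mx22.
  - by exists (2 * a), b, c, (2 * d); left; congr mx22; ring.
  - by exists (- 2 * a - 1), (- b), (- c), (- 2 * d - 1); left; congr mx22; ring.
  - by exists (2 * a), (- b), c, (- 2 * d - 1); left; congr mx22; ring.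
  - by exists (- 2 * a - 1), b, (- c), (2 * d); left; congr mx22; ring.
  - by exists (- 2 * a - 1), b, (- c), (2 * d); right; congr mx22; ring.
  - by exists (2 * a), (- b), c, (- 2 * d - 1); right; congr mx22; ring.
  - by exists (2 * a), b, c, (2 * d); right; congr mx22; ring.
  - by exists (- 2 * a - 1), (- b), (- c), (- 2 * d - 1); right; congr mx22; ring.
move=> [a [b [c [d EM]]]]; have [] := @odd_even_det a b c d.
  by case: EM uM => -> /unit_mx22 /=; lia.
move=> s [t [a' [d' [s1 t1 Ea Ed rel]]]]; rewrite {}Ea {}Ed in EM.
(* The signs s and t of the odd entries select the form; the even entries are
   then determined up to the sign that the form puts in front of them. *)
case: s1 t1 EM rel => -> [] -> EM rel.
- exists a', b, c, d'; split; first by lia.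
  by case: EM => ->; rewrite !opp_mx22;
     [left | do 6!right; left]; congr mx22; ring.
- exists a', (- b), c, d'; split; first by lia.
  by case: EM => ->; rewrite !opp_mx22;
     [do 2!right; left | do 5!right; left]; congr mx22; ring.
- exists a', b, (- c), d'; split; first by lia.
  by case: EM => ->; rewrite !opp_mx22;
     [do 3!right; left | do 4!right; left]; congr mx22; ring.
- exists a', (- b), (- c), d'; split; first by lia.
  by case: EM => ->; rewrite !opp_mx22;
     [right; left | do 7!right]; congr mx22; ring.
Qed.

Theorem proposition4p2 (M : 'M[int]_2) :
  M \in unitmx ->
  ((exists alpha : {multiplicative F2 -> F2},
      palindromic_aut alpha /\ phi alpha = M)
   <->
   exists a11 a12 a21 a22 : int,
     a11 + a22 - a12 * a21 + 4 * a11 * a22 = 0 /\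
     (M =   mx22 (1 + 4 * a11) (2 * a12) (2 * a21) (1 + 4 * a22) \/
      M = - mx22 (1 + 4 * a11) (2 * a12) (2 * a21) (1 + 4 * a22) \/
      M =   mx22 (1 + 4 * a11) (- 2 * a12) (2 * a21) (- 1 - 4 * a22) \/
      M = - mx22 (1 + 4 * a11) (- 2 * a12) (2 * a21) (- 1 - 4 * a22) \/
      M =   mx22 (2 * a12) (- 1 - 4 * a11) (1 + 4 * a22) (- 2 * a21) \/
      M = - mx22 (2 * a12) (- 1 - 4 * a11) (1 + 4 * a22) (- 2 * a21) \/
      M =   mx22 (2 * a12) (1 + 4 * a11) (1 + 4 * a22) (2 * a21) \/
      M = - mx22 (2 * a12) (1 + 4 * a11) (1 + 4 * a22) (2 * a21))).
Proof.
move=> uM; split=> [RM|forms].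
  by apply/(parity_eight_forms _ uM); apply: realizable_perm_mod2.
by apply: perm_mod2_realizable => //; apply/(parity_eight_forms _ uM).
Qed.
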